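(* For every even $n\ge 4$ (respectively, every odd $n\ge 3$), there exist a convex $n$-gon $G\subset\mathbf{R}^2$ with vertices $G_1,\dots,G_n$ and two convex polygons $A_0,A_1\subset G$ having $n$ (respectively, $n+1$) common supporting lines, such that there are no $i\in\{0,1\}$ and $j\in\{1,\dots,n\}$ with \[ A_i \subset \mathrm{Conv}\Bigl(A_{1-i}\cup\bigcup_{k\ne j}\{G_k\}\Bigr).\]
   Context: $\mathrm{Conv}$ denotes the convex hull, and $\subset$ means not necessarily strict inclusion. Convex polygons are filled, i.e. equal to the convex hull of their vertices. A line $l$ supports a compact set $A\subset\mathbf{R}^2$ if $l\cap A$ is nonempty and $A$ lies in one of the closed half-planes bounded by $l$. A line $l$ is a common supporting line of $A_0$ and $A_1$ if it supports both $A_0$ and $A_1$ and both sets lie in the same closed half-plane bounded by $l$. *)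

(* Defs.v *)
From mathcomp Require Import all_boot all_order all_algebra.
From mathcomp Require Import all_classical all_reals all_analysis.

Set Implicit Arguments.
Unset Strict Implicit.
Unset Printing Implicit Defensive.

Import Order.TTheory GRing.Theory Num.Theory.

Local Open Scope classical_set_scope.
Local Open Scope ring_scope.

Definition Conv (R : realType) (X : set 'rV[R]_2) : set 'rV[R]_2 :=
  smallest [set C : set 'rV[R]_2 | convex_set C] X.

(* [P] is the filled convex [n]-gon with vertices [v 0, ..., v (n-1)]: no [v i]
   lies in the hull of the others, so the [v i] are distinct and are exactly the
   vertices of [P], and [P] has nonempty interior since [3 <= n].  The labelling
   need not follow the boundary of [P]. *)
Definition convex_ngon (R : realType) (n : nat) (v : 'I_n -> 'rV[R]_2)
    (P : set 'rV[R]_2) : Prop :=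
  [/\ (3 <= n)%N,
      P = Conv (range v)
    & forall i : 'I_n, ~ Conv (v @` [set k | k != i]) (v i)].

Definition convex_polygon (R : realType) (P : set 'rV[R]_2) : Prop :=
  exists (n : nat) (v : 'I_n -> 'rV[R]_2), convex_ngon v P.

Definition dot (R : realType) (a x : 'rV[R]_2) : R := \sum_(i < 2) a 0 i * x 0 i.

Definition is_line (R : realType) (l : set 'rV[R]_2) : Prop :=
  exists (a : 'rV[R]_2) (c : R), a != 0 /\ l = [set x | dot a x = c].

(* Each line bounds two closed half-planes: the other one comes from
   [- a] and [- c]. *)
Definition closed_halfplane (R : realType) (l H : set 'rV[R]_2) : Prop :=
  exists (a : 'rV[R]_2) (c : R),
    [/\ a != 0, l = [set x | dot a x = c] & H = [set x | dot a x <= c]].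

Definition supports (R : realType) (l A : set 'rV[R]_2) : Prop :=
  [/\ is_line l, l `&` A !=set0
    & exists2 H, closed_halfplane l H & A `<=` H].

Definition common_supporting_line (R : realType) (A0 A1 l : set 'rV[R]_2) : Prop :=
  [/\ supports l A0, supports l A1
    & exists2 H, closed_halfplane l H & A0 `<=` H /\ A1 `<=` H].

(* Lines are counted as subsets of the plane; "having m" means exactly m. *)
Definition has_common_supporting_lines (R : realType) (m : nat)
    (A0 A1 : set 'rV[R]_2) : Prop :=
  ([set l | common_supporting_line A0 A1 l] #= `I_m)%card.

(* Main.v *)
Require Import Defs.
From mathcomp Require Import all_boot all_order all_algebra.
From mathcomp Require Import all_classical all_reals all_analysis.
From mathcomp Require Import zify ring lra.
Import Order.TTheory GRing.Theory Num.Theory.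
Local Open Scope classical_set_scope.
Local Open Scope ring_scope.

(** Take the 2n points P(u) = (u, u^2), u < 2n, on a parabola, split them into
    n consecutive pairs {2j, 2j+1}, and colour the pairs alternately 01, 10, 01,
    10, and so on.  A_0 and A_1 are the hulls of the two colour classes; each is
    an n-gon with one vertex in each pair.

    A line is a common supporting line of A_0 and A_1 exactly when it supports
    the hull of all the P(u) and contains points of both colours.  As the P(u)
    are in strictly convex position, such a line carries a side of their 2n-gon
    with endpoints of different colours ([support_parab]).  The sides inside the
    n pairs are two-coloured, those between consecutive pairs are one-coloured,
    and the side that closes the 2n-gon, from P(2n-1) to P(0), is two-coloured
    exactly when n is odd.  This gives n lines for even n and n+1 lines for odd n
    ([common_chords]).

    G is obtained from the 2n-gon by dropping the n sides inside the pairs and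
    extending the n other sides until they meet, so that its k-th vertex lies
    just outside the side of the k-th pair.  Hence all the P(u) lie on the
    boundary of G ([parab_in]).  The tangent to the parabola at P(u) cuts off
    P(u), together with at most the vertex of G belonging to the pair of u, from
    all the other P(w) and all the other vertices of G ([tangent_parab_lt],
    [gvert_tangent]).  So the vertex of A_i in the j-th pair is not in the hull
    of A_(1-i) and the G_k with k different from j.  The same fact yields the
    convex position of the G_k: if G_j were in the hull of the others, that hull
    would be all of G and would contain A_i. *)

(** * Convex hulls and half-planes *)

Lemma convex_setE (R : realType) (C : set 'rV[R]_2) :
  convex_set C <->
  forall (x y : 'rV[R]_2) (l : R), 0 <= l -> l <= 1 -> C x -> C y ->
    C (l *: x + (1 - l) *: y).
Proof.
split=> [cC x y l l0 l1 Cx Cy | cC x y l /set_mem Cx /set_mem Cy].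
  by have /set_mem := cC x y (Itv01 l0 l1) (mem_set Cx) (mem_set Cy).
by apply/mem_set; apply: cC.
Qed.

Lemma convex_Conv (R : realType) (X : set 'rV[R]_2) : convex_set (Conv X).
Proof.
apply/convex_setE => x y l l0 l1 Xx Xy C [cC XC].
by move/convex_setE: (cC); apply => //; [exact: Xx | exact: Xy].
Qed.

Lemma sub_Conv (R : realType) (X : set 'rV[R]_2) : X `<=` Conv X.
Proof. exact: sub_gen_smallest. Qed.

Lemma Conv_min (R : realType) (X C : set 'rV[R]_2) :
  convex_set C -> X `<=` C -> Conv X `<=` C.
Proof. exact: smallest_sub. Qed.

Lemma dotDZ (R : realType) (a x y : 'rV[R]_2) (l m : R) :
  dot a (l *: x + m *: y) = l * dot a x + m * dot a y.
Proof.
rewrite /dot !mulr_sumr -big_split; apply: eq_bigr => i _ /=.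
by rewrite !mxE; ring.
Qed.

Lemma convex_lt (R : realType) (a : 'rV[R]_2) (c : R) :
  convex_set [set x | dot a x < c].
Proof.
apply/convex_setE => x y l l0 l1 /= ax ay; rewrite dotDZ.
by have [->|l_neq0] := eqVneq l 0; first (by lra); nra.
Qed.

Lemma convex_le (R : realType) (a : 'rV[R]_2) (c : R) :
  convex_set [set x | dot a x <= c].
Proof. by apply/convex_setE => x y l l0 l1 /= ax ay; rewrite dotDZ; nra. Qed.

(** * Points of the parabola and their chords *)

Definition pt (R : realType) (x y : R) : 'rV[R]_2 :=
  \row_(i < 2) (if i == 0 then x else y).
Arguments pt {R}.

Lemma dot_pt (R : realType) (a b : R) (x : 'rV[R]_2) :
  dot (pt a b) x = a * x 0 0 + b * x 0 1.
Proof.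
rewrite /dot big_ord_recl big_ord1 !mxE.
by congr (_ + _ * x _ _); apply/val_inj.
Qed.

Lemma pt_neq0 (R : realType) (a b : R) : b != 0 -> pt a b != 0.
Proof. by apply: contra_neq => /rowP /(_ 1); rewrite !mxE. Qed.

Lemma pt_eta (R : realType) (x : 'rV[R]_2) : x = pt (x 0 0) (x 0 1).
Proof.
apply/rowP => i; rewrite mxE; case: eqP => [->//|/eqP i0].
by congr (x _ _); apply/val_inj; case: i i0 => [[|[|]]].
Qed.

Lemma segment_pt (R : realType) (C : set 'rV[R]_2) (a b x1 x2 x : R) :
  convex_set C -> C (pt x1 (a * x1 + b)) -> C (pt x2 (a * x2 + b)) ->
  x1 < x2 -> x1 <= x -> x <= x2 -> C (pt x (a * x + b)).
Proof.
move=> /convex_setE cC C1 C2 x12 x1x xx2.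
have e : (x2 - x1) != 0 by lra.
have p : 0 < x2 - x1 by lra.
have -> : pt x (a * x + b) =
    ((x2 - x) / (x2 - x1)) *: pt x1 (a * x1 + b) +
    (1 - (x2 - x) / (x2 - x1)) *: pt x2 (a * x2 + b).
  by apply/rowP => i; rewrite !mxE; case: ifP => _; field.
apply: cC => //; first by rewrite divr_ge0; lra.
by rewrite ler_pdivrMr //; lra.
Qed.

Definition parab (R : realType) (u : nat) : 'rV[R]_2 := pt u%:R (u%:R ^+ 2).

(** The tangent to the parabola at [parab u] is the line where the functional
    [dot (tangent u)] equals [u ^ 2]; the parabola lies on the side where the
    functional is smaller. *)
Definition tangent (R : realType) (u : nat) : 'rV[R]_2 := pt (u%:R *+ 2) (-1).

Lemma tangent_parab (R : realType) (u : nat) :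
  dot (tangent R u) (parab R u) = u%:R ^+ 2.
Proof. by rewrite dot_pt !mxE /=; ring. Qed.

(** The difference of the two sides is [(w - u) ^ 2]. *)
Lemma tangent_parab_lt (R : realType) (u w : nat) :
  w != u -> dot (tangent R u) (parab R w) < u%:R ^+ 2.
Proof.
rewrite -(eqr_nat R) -subr_eq0 dot_pt !mxE /= -subr_gt0 => wu.
suff -> : u%:R ^+ 2 - (u%:R *+ 2 * w%:R + -1 * w%:R ^+ 2) = (w%:R - u%:R) ^+ 2 :> R.
  by rewrite exprn_even_gt0.
by ring.
Qed.

Lemma parab_polygon (R : realType) (n : nat) (f : 'I_n -> nat) :
  (3 <= n)%N -> injective f ->
  convex_polygon (Conv (range (fun j => parab R (f j)))).
Proof.
move=> n3 f_inj; exists n, (fun j => parab R (f j)); split=> // i.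
suff H : Conv ((fun j => parab R (f j)) @` [set k | k != i]) `<=`
    [set x | dot (tangent R (f i)) x < (f i)%:R ^+ 2].
  by move=> /H /=; rewrite tangent_parab ltxx.
apply: Conv_min; first exact: convex_lt.
move=> _ [k /= ki <-]; apply: tangent_parab_lt.
by apply: contra ki => /eqP/f_inj->.
Qed.

Definition chord (R : realType) (p : nat * nat) : set 'rV[R]_2 :=
  [set x | dot (pt (p.1%:R + p.2%:R) (-1)) x = p.1%:R * p.2%:R].

(** The sign of [(u - s) * (u - t)] tells on which side of the chord from
    [parab s] to [parab t] the point [parab u] lies. *)
Lemma dot_chord (R : realType) (s t u : nat) :
  dot (pt (s%:R + t%:R) (-1)) (parab R u) =
  s%:R * t%:R - (u%:R - s%:R) * (u%:R - t%:R).
Proof. by rewrite dot_pt !mxE /=; ring. Qed.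

Lemma chord_parab (R : realType) (p : nat * nat) (u : nat) :
  chord R p (parab R u) <-> u = p.1 \/ u = p.2.
Proof.
rewrite /chord /= dot_chord; split=> [h|]; last by case=> ->; ring.
have /eqP : (u%:R - p.1%:R) * (u%:R - p.2%:R) = 0 :> R by lra.
by rewrite mulf_eq0 !subr_eq0 !eqr_nat => /orP[] /eqP; [left|right].
Qed.

(** Otherwise the open half-plane would be a convex set containing [X]. *)
Lemma Conv_touch (R : realType) (X : set 'rV[R]_2) (a : 'rV[R]_2) (c : R) :
  (forall x, X x -> dot a x <= c) ->
  forall x, Conv X x -> dot a x = c -> exists2 y, X y & dot a y = c.
Proof.
move=> Xc x Xx axc; apply: contrapT => noy.
suff H : Conv X `<=` [set z | dot a z < c].
  by have /= := H x Xx; rewrite axc ltxx.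
apply: Conv_min; first exact: convex_lt.
move=> y Xy /=; rewrite lt_neqAle Xc // andbT.
by apply/eqP => ayc; apply: noy; exists y.
Qed.

(** Reduces common supporting lines of two hulls to conditions on the generating
    points, with a single functional [dot a] describing the line and the common
    half-plane. *)
Lemma common_supporting_ConvP (R : realType) (X Y l : set 'rV[R]_2) :
  common_supporting_line (Conv X) (Conv Y) l <->
  exists (a : 'rV[R]_2) (c : R),
    [/\ a != 0, l = [set x | dot a x = c],
        forall x, (X `|` Y) x -> dot a x <= c
      & (exists2 x, X x & dot a x = c) /\ (exists2 y, Y y & dot a y = c)].
Proof.
split.
  move=> [[_ [x [lx Xx]] _] [_ [y [ly Yy]] _] [H [a [c [a0 le He]]] [XH YH]]].
  move: lx ly; rewrite le /= => lx ly.
  have Xc z : X z -> dot a z <= c.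
    by move=> Xz; have := XH _ (@sub_Conv _ _ _ Xz); rewrite He.
  have Yc z : Y z -> dot a z <= c.
    by move=> Yz; have := YH _ (@sub_Conv _ _ _ Yz); rewrite He.
  exists a, c; split=> //; first by move=> z [/Xc|/Yc].
  split; [exact: (Conv_touch _ X a c Xc x) | exact: (Conv_touch _ Y a c Yc y)].
move=> [a [c [a0 -> XYc [[x Xx ax] [y Yy ay]]]]].
have hH : closed_halfplane [set x | dot a x = c] [set x | dot a x <= c].
  by exists a, c.
have sX : Conv X `<=` [set x | dot a x <= c].
  by apply: Conv_min; [exact: convex_le | move=> z Xz; apply: XYc; left].
have sY : Conv Y `<=` [set x | dot a x <= c].
  by apply: Conv_min; [exact: convex_le | move=> z Yz; apply: XYc; right].
split; last by exists [set x | dot a x <= c].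
  split; [by exists a, c | by exists x; split=> //; exact: sub_Conv |].
  by exists [set x | dot a x <= c].
split; [by exists a, c | by exists y; split=> //; exact: sub_Conv |].
by exists [set x | dot a x <= c].
Qed.

(** On the parabola [dot a] is the quadratic polynomial
    [c + q * (u - s) * (u - t)] in [u], where [q] is the second coordinate of
    [a].  If [q < 0] it exceeds [c] strictly between [s] and [t], so these are
    consecutive; if [q > 0] it exceeds [c] below [s] and above [t], so these
    are the extreme indices. *)
Lemma support_parab (R : realType) (N s t : nat) (a : 'rV[R]_2) (c : R) :
  a != 0 -> (s < t < N)%N ->
  (forall u, (u < N)%N -> dot a (parab R u) <= c) ->
  dot a (parab R s) = c -> dot a (parab R t) = c ->
  [set x | dot a x = c] = chord R (s, t) /\
  (t = s.+1 \/ (s, t) = (0%N, N.-1)).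
Proof.
move=> a0 /andP[st tN].
rewrite (pt_eta _ a) in a0 *; move: (a 0 0) (a 0 1) a0 => {a} p q a0 le_c.
rewrite !dot_pt !mxE /= => es et.
have lst : s%:R < t%:R :> R by rewrite ltr_nat.
have ep : p = - q * (s%:R + t%:R).
  have : (t%:R - s%:R) * (p + q * (s%:R + t%:R)) = 0 by lra.
  by move/eqP; rewrite mulf_eq0 => /orP[] /eqP; lra.
have ec : c = - q * (s%:R * t%:R) by rewrite -es ep; ring.
have q0 : q != 0.
  apply: contraNneq a0 => q0; apply/eqP/rowP => i.
  by rewrite !mxE ep q0; case: ifP => _; ring.
have le_u u : (u < N)%N -> q * ((u%:R - s%:R) * (u%:R - t%:R)) <= 0.
  by move=> /le_c; rewrite dot_pt !mxE /= ep ec; lra.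
split.
  apply/seteqP; split=> x; rewrite /chord /= !dot_pt ep ec => h.
    by apply: (mulfI q0); lra.
  by have := congr1 (fun z => q * z) h; lra.
have [q_lt0|q_ge0] := ltP q 0.
  (* s.+1 < t would put parab s.+1 beyond the line *)
  left; apply/eqP; rewrite eqn_leq st andbT leqNgt; apply/negP => s1t.
  have : (s.+1 < N)%N by lia.
  move=> /le_u; rewrite -natr1.
  have : s%:R + 1 < t%:R :> R by rewrite natr1 ltr_nat.
  by nra.
right.
have q_gt0 : 0 < q by rewrite lt_neqAle eq_sym q0.
have s0 : s = 0%N.
  have /le_u : (0 < N)%N by lia.
  apply: contraPeq; rewrite -lt0n -(ltr_nat R) => s_gt0.
  apply/negP; rewrite -ltNge !sub0r mulrNN.
  by rewrite !mulr_gt0 //; exact: lt_trans lst.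
congr pair => //.
have /le_u : (N.-1 < N)%N by lia.
apply: contraPeq => tN1.
have : t%:R < N.-1%:R :> R by rewrite ltr_nat; lia.
move=> tN2; apply/negP; rewrite -ltNge.
by rewrite !mulr_gt0 ?subr_gt0 //; exact: lt_trans tN2.
Qed.

(** * The two polygons and their common supporting lines *)

(** The parity of [ceil (u / 2)], that is, the sequence 0, 1, 1, 0, 0, 1, 1, 0,
    and so on. *)
Definition colour (u : nat) : bool := odd u (+) odd u./2.

(** The index of colour [i] in the pair [{2j, 2j+1}]. *)
Definition vtx (i : bool) (j : nat) : nat := (j.*2 + (i (+) odd j))%N.

Lemma half_vtx i j : (vtx i j)./2 = j.
Proof. by rewrite /vtx; case: (_ (+) _); lia. Qed.

Lemma colour_vtx i j : colour (vtx i j) = i.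
Proof.
by rewrite /colour half_vtx /vtx oddD odd_double oddb addFb -addbA addbb addbF.
Qed.

Lemma vtx_colour u : vtx (colour u) u./2 = u.
Proof. by rewrite /vtx /colour -addbA addbb addbF addnC odd_double_half. Qed.

Lemma vtx_lt i j n : (j < n)%N -> (vtx i j < n.*2)%N.
Proof. by rewrite /vtx; case: (_ (+) _); lia. Qed.

(** Endpoints of the two-coloured sides of the 2n-gon; the value at [j = n], used
    for odd [n] only, is the closing side. *)
Definition bichord (n j : nat) : nat * nat :=
  if (j < n)%N then (j.*2, j.*2.+1) else (0%N, n.*2.-1).

Lemma bichord_inj (R : realType) n : (3 <= n)%N ->
  {in `I_n.+1 &, injective (fun j => chord R (bichord n j))}.
Proof.
move=> n3 j k /set_mem /= jn /set_mem /= kn e.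
have H u : (u = (bichord n j).1 \/ u = (bichord n j).2) ->
           (u = (bichord n k).1 \/ u = (bichord n k).2).
  by move=> /(chord_parab R) h; apply/(chord_parab R); rewrite -e.
have := H _ (or_introl erefl); have := H _ (or_intror erefl).
by rewrite /bichord; case: (ltnP j n) => ?; case: (ltnP k n) => ? /=; lia.
Qed.

Definition polyA (R : realType) (n : nat) (i : bool) : set 'rV[R]_2 :=
  range (fun j : 'I_n => parab R (vtx i j)).

Lemma polyA_parab (R : realType) n u : (u < n.*2)%N ->
  polyA R n (colour u) (parab R u).
Proof.
move=> un; have hu : (u./2 < n)%N by lia.
by exists (Ordinal hu) => //=; rewrite vtx_colour.
Qed.

(** A chord with consecutive or extreme endpoints has all the points of the
    parabola on one side; the sign [e] says which one. *)
Lemma bichord_side (R : realType) n j : exists2 e : R, e != 0 &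
  forall u, (u < n.*2)%N ->
    0 <= e * ((u%:R - (bichord n j).1%:R) * (u%:R - (bichord n j).2%:R)).
Proof.
rewrite /bichord; case: (ltnP j n) => _ /=.
  exists 1 => [|u _]; first exact: oner_neq0.
  by rewrite -natr1; case: (leqP u j.*2); rewrite -(ler_nat R) -?natr1; nra.
exists (-1) => [|u un]; first by rewrite oppr_eq0 oner_neq0.
have : u%:R <= n.*2.-1%:R :> R by rewrite ler_nat; lia.
have : 0 <= u%:R :> R by [].
by nra.
Qed.

(** The inclusion from left to right is where the colours matter: by
    [support_parab] the line carries a side of the 2n-gon, and a side from 2k+1 to
    2k+2 has both endpoints of the same colour. *)
Lemma common_chords (R : realType) (n : nat) : (3 <= n)%N ->
  [set l | common_supporting_line (Conv (polyA R n false)) (Conv (polyA R n true)) l]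
  = (fun j => chord R (bichord n j)) @` `I_(if odd n then n.+1 else n).
Proof.
move=> n3; apply/seteqP; split=> l /=.
  move=> /common_supporting_ConvP [a [c [a0 -> le_c]]].
  move=> [[_ [j0 _ <-] e0] [_ [j1 _ <-] e1]].
  have le_u u : (u < n.*2)%N -> dot a (parab R u) <= c.
    move=> un; apply: le_c; have := polyA_parab R n u un.
    by case: (colour u); [right|left].
  have : (vtx false j0 < n.*2)%N /\ (vtx true j1 < n.*2)%N by split; exact: vtx_lt.
  have : colour (vtx false j0) != colour (vtx true j1) by rewrite !colour_vtx.
  move: (vtx false j0) (vtx true j1) e0 e1 => s t.
  wlog st : s t / (s < t)%N.
    move=> H es et cst [sn tn]; case: (ltngtP s t) => [st|ts|est].
    - exact: (H s t).
    - by apply: (H t s) => //; rewrite eq_sym.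
    - by rewrite est eqxx in cst.
  move=> es et cst [sn tn].
  have stn : (s < t < n.*2)%N by rewrite st.
  have [-> {es et}] := support_parab _ _ _ _ _ _ a0 stn le_u es et.
  case=> [et|[es et]]; last first.
    exists n; last by rewrite /bichord ltnn es et.
    suff -> : odd n by [].
    move: cst; rewrite es et /colour /=.
    have -> : (n.*2.-1)./2 = n.-1 by lia.
    have -> : odd n.*2.-1 = true by lia.
    by case: n n3 {le_c le_u j0 j1 sn tn stn es et} => //= n _; case: (odd n).
  exists s./2; last first.
    rewrite /bichord; have -> : (s./2 < n)%N by lia.
    suff : ~~ odd s by move=> so; congr (chord R (_, _)); lia.
    apply: contra cst => so; rewrite et /colour /=.
    have -> : (uphalf s) = s./2.+1 by lia.
    by rewrite /= so; case: (odd s./2).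
  by case: ifP => _ /=; lia.
move=> [j jn <-]; apply/common_supporting_ConvP.
have [e e0 sgn] := bichord_side R n j.
set s := (bichord n j).1 in sgn; set t := (bichord n j).2 in sgn.
have dote x : dot (pt (e * (s%:R + t%:R)) (- e)) x =
    e * dot (pt (s%:R + t%:R) (-1)) x by rewrite !dot_pt; ring.
have on_bichord u : u = s \/ u = t -> dot (pt (e * (s%:R + t%:R)) (- e)) (parab R u) =
    e * (s%:R * t%:R).
  by move=> /(chord_parab R (bichord n j)) h; rewrite dote h.
exists (pt (e * (s%:R + t%:R)) (- e)), (e * (s%:R * t%:R)); split.
- by rewrite pt_neq0 // oppr_eq0.
- apply/seteqP; split=> x /=; rewrite dote; first by move->.
  exact: (mulfI e0).
- by move=> x [] [k _ <-]; rewrite dote dot_chord mulrBr gerBl;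
    apply: sgn; exact: vtx_lt.
have [sn tn cst] : [/\ (s < n.*2)%N, (t < n.*2)%N & colour s != colour t].
  rewrite /s /t /bichord; case: (ltnP j n) => hj /=.
    rewrite ltn_double ltn_Sdouble hj; split=> //.
    by rewrite /colour /= uphalf_double doubleK odd_double; case: (odd j).
  have on : odd n by move: jn; case: (odd n) => //; rewrite ltnNge hj.
  split; [lia | lia | rewrite /colour /=].
  have -> : (n.*2.-1)./2 = n.-1 by lia.
  have -> : odd n.*2.-1 = true by lia.
  by have -> : odd n.-1 = false by lia.
have := polyA_parab R n s sn; have := polyA_parab R n t tn.
have es := on_bichord s (or_introl erefl); have et := on_bichord t (or_intror erefl).
move: cst; case: (colour s); case: (colour t) => // _ At As.
  by split; [exists (parab R t) | exists (parab R s)].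
by split; [exists (parab R s) | exists (parab R t)].
Qed.

(** * The circumscribed n-gon *)

(** The horizontal distance by which the closing side, extended to G_0 and
    G_(n-1), sticks out beyond the points [parab 0] and [parab (2n-1)]. *)
Definition overhang (R : realType) (n : nat) : R := (n%:R - 2)^-1.

(** [(gx n k, gy n k)] is the intersection of the chord from 2k-1 to 2k with the
    chord from 2k+1 to 2k+2, indices being read modulo 2n.  For [0 < k < n-1] these
    chords have slopes 4k-1 and 4k+3 and meet at abscissa 2k + 1/2, at distance
    3/4 vertically below the parabola.  For [k = 0] and [k = n-1] one of them is the closing chord
    [y = (2n-1) x]. *)
Definition gx (R : realType) (n k : nat) : R :=
  if k == 0%N then - overhang R n
  else if k == n.-1 then n%:R *+ 2 - 1 + overhang R n
  else k%:R *+ 2 + 2^-1.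

Definition gy (R : realType) (n k : nat) : R :=
  if (k == 0%N) || (k == n.-1) then (n%:R *+ 2 - 1) * gx R n k
  else gx R n k ^+ 2 - 3 / 4.

Definition gvert (R : realType) (n k : nat) : 'rV[R]_2 := pt (gx R n k) (gy R n k).

Lemma overhang_gt0 (R : realType) n : (3 <= n)%N -> 0 < overhang R n.
Proof. by rewrite -(ler_nat R) => n3; rewrite invr_gt0; lra. Qed.

Lemma natr_double (R : realType) k : k.*2%:R = k%:R *+ 2 :> R.
Proof. by rewrite -mul2n natrM mulr_natl. Qed.

Lemma overhangE (R : realType) n : (3 <= n)%N ->
  overhang R n * n%:R = 1 + overhang R n *+ 2.
Proof.
rewrite -(ler_nat R) => n3.
have : (n%:R - 2) * overhang R n = 1 by rewrite divff //; lra.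
by lra.
Qed.

(** G_k and G_(k+1) lie on the chord from 2k+1 to 2k+2, on either side of its two
    endpoints. *)
Lemma gvert_edge (R : realType) n k : (3 <= n)%N -> (k.+1 < n)%N ->
  [/\ gy R n k = (k%:R *+ 4 + 3) * gx R n k - (k%:R *+ 2 + 1) * (k%:R *+ 2 + 2),
      gy R n k.+1 = (k%:R *+ 4 + 3) * gx R n k.+1 - (k%:R *+ 2 + 1) * (k%:R *+ 2 + 2),
      gx R n k < k%:R *+ 2 + 1 & k%:R *+ 2 + 2 < gx R n k.+1].
Proof.
move=> n3 kn.
have d0 := overhang_gt0 R n n3; have dn := overhangE R n n3.
have eN : (k.+1 == n.-1) -> n%:R = k%:R + 2 :> R.
  by move=> /eqP e; rewrite -natrD; congr _%:R; lia.
have ek1 : (k == n.-1) = false by lia.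
rewrite /gy /gx /= ek1 orbF.
move: (overhang R n) d0 dn => d d0 dn.
have e : k.+1%:R = k%:R + 1 :> R by rewrite natr1.
have k_ge0 : 0 <= k%:R :> R by [].
rewrite e; split.
- case: eqP => [->|_]; last by field.
  by have := dn; nra.
- case: (boolP (k.+1 == n.-1)) => [/eN eN'|_]; last by field.
  by move: dn; rewrite eN' => dn; nra.
- by case: eqP => [->|_]; lra.
- by case: ifP => [/eN->|_]; lra.
Qed.

(** For an inner vertex the claim reads [(gx k - u) ^ 2 > 3/4], and
    [gx k = 2k + 1/2] is at distance at least 3/2 from an index [u] outside the
    k-th pair; for an end vertex the 3/4 becomes [2 + 3d + d ^ 2], where [d] is the
    overhang, and the distance is at least [2 + d]. *)
Lemma gvert_tangent (R : realType) n k u : (3 <= n)%N -> (k < n)%N ->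
  (u < n.*2)%N -> k != u./2 -> dot (tangent R u) (gvert R n k) < u%:R ^+ 2.
Proof.
move=> n3 kn un ku.
have d0 := overhang_gt0 R n n3; have dn := overhangE R n n3.
rewrite dot_pt !mxE /= /gy /gx.
move: (overhang R n) d0 dn => d d0 dn.
have u_ge0 : 0 <= u%:R :> R by [].
have [k0|k_neq0] /= := eqVneq k 0%N.
  have : 2 <= u%:R :> R by rewrite (ler_nat R 2); lia.
  by nra.
have [kl|k_neql] /= := eqVneq k n.-1.
  have : u%:R <= n%:R *+ 2 - 3 :> R.
    by rewrite lerBrDr -natr_double -natrD ler_nat; lia.
  by nra.
have [hu|hu] : (u.+1 <= k.*2)%N \/ (k.+1.*2 <= u)%N by lia.
  have : u%:R + 1 <= k%:R *+ 2 :> R.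
    by rewrite natr1 -natr_double ler_nat; lia.
  by nra.
have : k%:R *+ 2 + 2 <= u%:R :> R.
  by rewrite -natr_double -natrD ler_nat; lia.
by nra.
Qed.

(** Each point lies on a side of G: the k-th side contains the points 2k+1 and
    2k+2, the closing side the first and the last point. *)
Lemma parab_in (R : realType) n u : (3 <= n)%N -> (u < n.*2)%N ->
  Conv (range (fun k : 'I_n => gvert R n k)) (parab R u).
Proof.
move=> n3 un; set C := Conv _.
have cC : convex_set C := convex_Conv _ _.
have vC k : (k < n)%N -> C (gvert R n k).
  by move=> kn; apply: sub_Conv; exists (Ordinal kn).
have on_side k : (k.+1 < n)%N -> u = k.*2.+1 \/ u = k.*2.+2 -> C (parab R u).
  move=> kn uk; have [e0 e1 lt0 lt1] := gvert_edge R n k n3 kn.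
  have eu : u%:R = k%:R *+ 2 + 1 :> R \/ u%:R = k%:R *+ 2 + 2 :> R.
    by case: uk => ->; [left|right]; rewrite -natr_double ?natr1 // -natrD addn2.
  have -> : parab R u = pt u%:R ((k%:R *+ 4 + 3) * u%:R +
      - ((k%:R *+ 2 + 1) * (k%:R *+ 2 + 2))).
    by rewrite /parab; congr pt; case: eu => ->; ring.
  apply: (segment_pt _ _ _ _ (gx R n k) (gx R n k.+1)) => //.
  - by rewrite -e0; apply: vC; lia.
  - by rewrite -e1; exact: vC.
  - by case: eu; lra.
  - by case: eu; lra.
  - by case: eu; lra.
have [[k kn uk]|eu] : (exists2 k, (k.+1 < n)%N & u = k.*2.+1 \/ u = k.*2.+2) \/
    (u = 0 \/ u = n.*2.-1)%N.
  have [->|u_gt0] := posnP u; first by right; left.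
  have [->|u_neql] := eqVneq u n.*2.-1; first by right; right.
  by left; exists (u.-1)./2; lia.
- exact: (on_side k).
(* the remaining two points lie on the closing side of G *)
have d0 := overhang_gt0 R n n3.
have n3R : 3 <= n%:R :> R by rewrite (ler_nat R 3).
have eu' : u%:R = 0 :> R \/ u%:R = n%:R *+ 2 - 1 :> R.
  by case: eu => ->; [left|right; rewrite -natr_double -subn1 natrB //; lia].
have -> : parab R u = pt u%:R ((n%:R *+ 2 - 1) * u%:R + 0).
  by rewrite /parab; congr pt; case: eu' => ->; ring.
have g0 : gx R n 0 = - overhang R n by [].
have gl : gx R n n.-1 = n%:R *+ 2 - 1 + overhang R n.
  by rewrite /gx eqxx; case: eqP => //; lia.
apply: (segment_pt _ _ _ _ (gx R n 0) (gx R n n.-1)) => //.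
- by rewrite addr0; have := vC 0%N; rewrite /gvert /gy /=; apply; lia.
- by rewrite addr0; have := vC n.-1; rewrite /gvert /gy eqxx orbT; apply; lia.
- by rewrite g0 gl; lra.
- by rewrite g0; case: eu' => ->; lra.
- by rewrite gl; case: eu' => ->; lra.
Qed.

(** * The theorem *)

Theorem mainTheorem3 (R : realType) (n : nat)
    (hn : (~~ odd n /\ (4 <= n)%N) \/ (odd n /\ (3 <= n)%N)) :
  exists (G : set 'rV[R]_2) (v : 'I_n -> 'rV[R]_2) (A : bool -> set 'rV[R]_2),
    [/\ convex_ngon v G,
        forall i, convex_polygon (A i) /\ A i `<=` G,
        has_common_supporting_lines (if odd n then n.+1 else n) (A false) (A true)
      & ~ exists (i : bool) (j : 'I_n),
            A i `<=` Conv (A (~~ i) `|` \bigcup_(k in [set k | k != j]) [set v k])].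
Proof.
have n3 : (3 <= n)%N by lia.
set v := fun k : 'I_n => gvert R n k.
set A := fun i => Conv (polyA R n i).
have AG i : A i `<=` Conv (range v).
  apply: Conv_min; first exact: convex_Conv.
  by move=> _ [j _ <-]; apply: parab_in => //; exact: vtx_lt.
(* the tangent at the vertex of A_i in the j-th pair separates it from the rest *)
have escape i j : ~ A i `<=`
    Conv (A (~~ i) `|` \bigcup_(k in [set k | k != j]) [set v k]).
  set u := vtx i j => sub.
  have /sub : A i (parab R u) by apply: sub_Conv; exists j.
  have H : Conv (A (~~ i) `|` \bigcup_(k in [set k | k != j]) [set v k]) `<=`
      [set x | dot (tangent R u) x < u%:R ^+ 2].
    apply: Conv_min; first exact: convex_lt.
    move=> x [Ax|[k /= kj ->]].
      apply: (Conv_min _ _ _ (convex_lt _ _ _) _ _ Ax) => _ [k _ <-].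
      apply: tangent_parab_lt; apply: contraTneq isT => /(congr1 colour).
      by rewrite !colour_vtx; case: (i).
    by apply: gvert_tangent; rewrite ?half_vtx //; exact: vtx_lt.
  by move=> /H /=; rewrite tangent_parab ltxx.
exists (Conv (range v)), v, A; split.
(* a redundant G_j would make the hull of the other G_k equal to G *)
- split=> // j vj; apply: (escape false j); apply: subset_trans (AG false) _.
  apply: Conv_min; first exact: convex_Conv.
  move=> _ [k _ <-]; have [->|kj] := eqVneq k j; last first.
    by apply: sub_Conv; right; exists k.
  apply: (Conv_min _ _ _ (convex_Conv _ _) _ _ vj) => _ [m mj <-].
  by apply: sub_Conv; right; exists m.
- move=> i; split; last exact: AG.
  apply: parab_polygon => // j k /(congr1 half).
  by rewrite !half_vtx => /val_inj.
- rewrite /has_common_supporting_lines common_chords //.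
  apply: inj_card_eq => j k /set_mem /= jn /set_mem /= kn.
  by apply: (bichord_inj R n) => //; apply/mem_set => /=; move: jn kn; case: ifP; lia.
- by move=> [i [j]]; exact: escape.
Qed.
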